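(* Let $n,t$ be integers with $n\neq t^3$. If $n-t^3\not\equiv 0\pmod 3$, then there are no $(x,y,z)\in\mathbb{Z}^3$ with $x^3+y^3+z^3=n$ and $x+y+z=t$. If $n-t^3\equiv 0\pmod 3$, put $N(t,n)=\frac{n-t^3}{3}$; then the number of triples $(x,y,z)\in\mathbb{Z}^3$ with $$x^3+y^3+z^3=n,\qquad x+y+z=t$$ is $$R(t,n)=\sum_{\substack{d\mid N(t,n)\\ \delta\mid d\\ \delta+d/\delta+N(t,n)/d=-2t}}1,$$ where the sum is over pairs $(d,\delta)$ of nonzero integers (of either sign) such that $d$ divides $N(t,n)$, $\delta$ divides $d$, and $\delta+d/\delta+N(t,n)/d=-2t$. Furthermore, if $n=t^3$, then there are infinitely many such triples $(x,y,z)$.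
   Context: Representations are ordered triples of integers. Divisors are allowed to be negative: the conditions ''$0\neq \mathrm{abs}(d)\mid \mathrm{abs}(N)$'' and ''$0\neq\mathrm{abs}(\delta)\mid\mathrm{abs}(d)$'' mean that $d$ and $\delta$ run over nonzero integers of either sign with $|d|$ dividing $|N|$ and $|\delta|$ dividing $|d|$. *)

(* Defs.v *)
From HB Require Import structures.
From mathcomp Require Import all_boot all_order all_algebra.
From mathcomp Require Import all_classical.

Set Implicit Arguments.
Unset Strict Implicit.
Unset Printing Implicit Defensive.

Import GRing.Theory.
Local Open Scope classical_set_scope.
Local Open Scope ring_scope.

Definition cube_sum_triples (t n : int) : set (int * int * int) :=
  [set v | let: (x, y, z) := v in
           x ^+ 3 + y ^+ 3 + z ^+ 3 = n /\ x + y + z = t].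

(* Exact division when n - t ^+ 3 is divisible by 3, the only case of use. *)
Definition N (t n : int) : int := ((n - t ^+ 3) %/ 3)%Z.

(* [dvdz] and [divz] are signed: d and delta range over both signs. All the
   quotients below are exact. *)
Definition divisor_pairs (t n : int) : set (int * int) :=
  [set p | let: (d, delta) := p in
           [/\ d != 0, delta != 0, (d %| N t n)%Z, (delta %| d)%Z
             & delta + (d %/ delta)%Z + (N t n %/ d)%Z = - 2 * t]].

(* The index set is finite as soon as N t n != 0, so the sum over a finite
   support does not take its default value. *)
Definition R (t n : int) : nat := \sum_(p \in divisor_pairs t n) 1%N.

(* Main.v *)
Require Import Defs.
From mathcomp Require Import all_boot all_order all_algebra.
From mathcomp Require Import all_classical.
From mathcomp Require Import finmap ring.

Import GRing.Theory.
Local Open Scope classical_set_scope.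
Local Open Scope card_scope.
Local Open Scope ring_scope.

Set Implicit Arguments.
Unset Strict Implicit.
Unset Printing Implicit Defensive.

(** When [x + y + z = t], the polarization of the cube reads
      [n - t ^+ 3 = - 3 (x + y) (y + z) (z + x) = 3 (x - t) (y - t) (z - t)],
    because [x + y = t - z] and cyclically.  So a solution forces [3] to divide
    [n - t ^+ 3], and the shifted coordinates [a = x - t], [b = y - t],
    [c = z - t] satisfy [a * b * c = N t n] and [a + b + c = - 2 * t]
    ([shifted_product]); conversely such [a], [b], [c] give a solution.

    If [n <> t ^+ 3], the product [a * b * c] is nonzero, so the ordered
    factorizations [N t n = a * b * c] are parametrized by [d = a * b] and
    [delta = a], with [b = d / delta] and [c = N t n / d].  This is the
    bijection of [cube_sum_triplesE] and [triple_of_pair_inj]; both sides are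
    finite since a nonzero integer has finitely many divisors.

    If [n = t ^+ 3], the equation becomes [a * b * c = 0], and [a = 0] leaves
    the whole line of solutions [(t, k, - k)]. *)

(** The usual identity for [(x + y + z) ^+ 3], with each factor [x + y] written
    as [t - z]: this makes the three factors functions of single coordinates,
    so that a factorization determines the triple. *)
Lemma shifted_product (x y z : int) :
  let t := x + y + z in
  x ^+ 3 + y ^+ 3 + z ^+ 3 - t ^+ 3 = (x - t) * (y - t) * (z - t) * 3.
Proof. by move=> t; rewrite /t; ring. Qed.

Lemma cube_sum_divisible (x y z n t : int) :
  x ^+ 3 + y ^+ 3 + z ^+ 3 = n -> x + y + z = t -> (n - t ^+ 3 = 0 %[mod 3])%Z.
Proof. by move=> <- <-; rewrite shifted_product modzMl mod0z. Qed.

Lemma N_exact (t n : int) :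
  (n - t ^+ 3 = 0 %[mod 3])%Z -> n - t ^+ 3 = N t n * 3.
Proof. by move=> h; rewrite /N divzK //; apply/dvdz_mod0P; rewrite h mod0z. Qed.

Lemma N_neq0 (t n : int) :
  n <> t ^+ 3 -> (n - t ^+ 3 = 0 %[mod 3])%Z -> N t n != 0.
Proof.
move=> nt /N_exact e; apply/eqP => N0; apply: nt.
by apply/eqP; rewrite -subr_eq0 e N0 mul0r.
Qed.

(** On triples with [x <> t] and [y <> t], the inverse of
    [(x, y, z) |-> ((x - t) * (y - t), x - t)]. *)
Definition triple_of_pair (t n : int) (p : int * int) : int * int * int :=
  (t + p.2, t + (p.1 %/ p.2)%Z, t + (N t n %/ p.1)%Z).

(** Here [N t n != 0] is essential: it makes [x - t] and [y - t] nonzero, hence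
    legitimate divisors, for every solution. *)
Lemma cube_sum_triplesE (t n : int) :
  n <> t ^+ 3 -> (n - t ^+ 3 = 0 %[mod 3])%Z ->
  cube_sum_triples t n = triple_of_pair t n @` divisor_pairs t n.
Proof.
move=> nt h; have N0 := N_neq0 nt h; have eN := N_exact h.
apply/seteqP; split.
- move=> [[x y] z] /= [ecube esum].
  have abc : N t n = (x - t) * (y - t) * (z - t).
    apply: (@mulIf _ (3 : int)) => //.
    by rewrite -eN -ecube -esum shifted_product.
  move: N0; rewrite abc mulf_eq0 negb_or => /andP[ab0 c0].
  have := ab0; rewrite mulf_eq0 negb_or => /andP[a0 b0].
  exists ((x - t) * (y - t), x - t); last first.
    by rewrite /triple_of_pair abc /= !mulKz // !(addrC t) !subrK.
  rewrite /divisor_pairs /= abc !mulKz //; split=> //.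
  + exact: dvdz_mulr.
  + exact: dvdz_mulr.
  + by rewrite -esum; ring.
- move=> _ [[d delta] /= [d0 delta0 dN deltad esum] <-].
  rewrite /triple_of_pair /cube_sum_triples /=.
  have eabc : delta * (d %/ delta)%Z * (N t n %/ d)%Z = N t n.
    by rewrite [delta * _]mulrC divzK // mulrC divzK.
  move: eabc esum; set b := (d %/ delta)%Z; set c := (N t n %/ d)%Z.
  move=> eabc esum.
  have et : t + delta + (t + b) + (t + c) = t.
    have -> : t + delta + (t + b) + (t + c) = 3 * t + (delta + b + c) by ring.
    by rewrite esum; ring.
  split=> //; apply/eqP; rewrite -(inj_eq (addIr (- t ^+ 3))) eN -eabc.
  have := shifted_product (t + delta) (t + b) (t + c).
  by rewrite /= et => ->; apply/eqP; ring.
Qed.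

(** The first two coordinates suffice: they give [delta] and [d / delta], whose
    product is [d]. *)
Lemma triple_of_pair_inj (t n : int) :
  {in divisor_pairs t n &, injective (triple_of_pair t n)}.
Proof.
move=> [d delta] [d' delta'] /set_mem[_ _ _ dd _] /set_mem[_ _ _ dd' _] [/addrI e /addrI e' _].
by rewrite -(divzK dd) -(divzK dd') /= e' e.
Qed.

(** Sign and absolute value exhibit this set as the image of a finite one. *)
Lemma finite_int_le (m : nat) : finite_set [set d : int | (`|d| <= m)%N].
Proof.
apply: (@sub_finite_set _ _
  ((fun p : bool * nat => (-1) ^+ p.1 * (p.2 : int))
     @` (@setT bool `*` `I_m.+1))).
  by move=> d /= dm; exists ((d < 0)%R, `|d|%N); rewrite /= -?intEsign.
by apply: finite_image; apply: finite_setX; [exact: finite_finset|exact: finite_II].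
Qed.

Lemma dvdz_leq (d m : int) : m != 0 -> (d %| m)%Z -> (`|d| <= `|m|)%N.
Proof. by move=> m0; apply: dvdn_leq; rewrite absz_gt0. Qed.

Lemma finite_divisor_pairs (t n : int) :
  N t n != 0 -> finite_set (divisor_pairs t n).
Proof.
move=> N0; pose B := [set d : int | (`|d| <= `|N t n|)%N].
apply: (@sub_finite_set _ _ (B `*` B)); last first.
  by apply: finite_setX; exact: finite_int_le.
move=> [d delta] /= [d0 _ dN deltad _]; split; apply: dvdz_leq => //.
exact: dvdz_trans deltad dN.
Qed.

Lemma card_eq_sum1 (T : choiceType) (A : set T) :
  finite_set A -> A #= `I_(\sum_(p \in A) 1%N).
Proof.
move=> fA; have [k Ak] := fA.
by rewrite fsbig_finite // -card_fset_sum1 (card_fset_set Ak).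
Qed.

Lemma infinite_cube_line (t : int) : infinite_set (cube_sum_triples t (t ^+ 3)).
Proof.
pose f (k : nat) : int * int * int := (t, k : int, - (k : int)).
have f_inj : {in [set: nat] &, injective f} by move=> k l _ _ [].
have ff : f @` [set: nat] `<=` cube_sum_triples t (t ^+ 3).
  by move=> _ [k _ <-]; rewrite /cube_sum_triples /f /=; split; ring.
move=> /(sub_finite_set ff) fin; apply: infinite_nat.
by rewrite -(eq_finite_set (inj_card_eq f_inj)).
Qed.

Theorem theorem2 (n t : int) :
  [/\ n <> t ^+ 3 -> (n - t ^+ 3 <> 0 %[mod 3])%Z ->
        ~ exists x y z : int,
            x ^+ 3 + y ^+ 3 + z ^+ 3 = n /\ x + y + z = t,
      n <> t ^+ 3 -> (n - t ^+ 3 = 0 %[mod 3])%Z ->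
        cube_sum_triples t n #= `I_(R t n)
    & n = t ^+ 3 -> infinite_set (cube_sum_triples t n)].
Proof.
split=> [_ ndiv [x [y [z [ecube esum]]]]|nt h|->].
- exact: ndiv (cube_sum_divisible ecube esum).
- rewrite (cube_sum_triplesE nt h).
  apply: card_eq_trans (card_eq_sum1 (finite_divisor_pairs (N_neq0 nt h))).
  exact: inj_card_eq (@triple_of_pair_inj t n).
- exact: infinite_cube_line.
Qed.
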